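(* Consider the three families of Möb-homogeneous analytic Hilbert modules $$\{\mathcal{A}^{(\lambda,\mu,\nu)}:\lambda,\mu,\nu>0\},\qquad \{\mathcal{H}^{(\alpha,\beta,\gamma)}:\alpha,\beta>\gamma>0\},\qquad \{\mathbb{H}^{(\alpha,\beta,\gamma,\eta)}:\alpha,\beta>\gamma>0,\ \eta>0\}.$$ No module belonging to any one of these three families is unitarily equivalent to a module belonging to another of the three families. Moreover, no module belonging to any of these three families is unitarily equivalent to a weighted Bergman module $\mathbb{A}^{(\rho_1,\rho_2)}(\mathbb{D}^2)$, $\rho_1,\rho_2>0$.
   Context: $\mathbb{D}$ is the open unit disc in $\mathbb{C}$. All the following are reproducing kernel Hilbert spaces of holomorphic functions on $\mathbb{D}^2$, given by non-negative definite kernels (principal branches of powers), with $\boldsymbol z=(z_1,z_2)$, $\boldsymbol w=(w_1,w_2)\in\mathbb{D}^2$. $\mathcal{A}^{(\lambda,\mu,\nu)}$ ($\lambda,\mu,\nu>0$) has kernel $$K^{(\lambda,\mu,\nu)}(\boldsymbol z,\boldsymbol w)=\frac{1}{4(1-z_1\bar w_1)^{\mu+\lambda}(1-z_2\bar w_2)^{\nu+\lambda}}\left[\frac{1}{(1-z_1\bar w_1)^{2\lambda}(1-z_2\bar w_2)^{2\lambda}}+\frac{3}{(1-z_1\bar w_2)^{2\lambda}(1-z_2\bar w_1)^{2\lambda}}\right].$$ $\mathcal{H}^{(\alpha,\beta,\gamma)}$ ($\alpha,\beta>\gamma>0$) has kernel $$B_{(\alpha,\beta,\gamma)}(\boldsymbol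 z,\boldsymbol w)=(1-z_1\overline{w}_1)^{-\alpha}(1-z_2\overline{w}_2)^{-\beta}(1-z_1\overline{w}_2)^{\gamma}(1-z_2\overline{w}_1)^{\gamma}.$$ $\mathbb{H}^{(\alpha,\beta,\gamma,\eta)}$ ($\alpha,\beta>\gamma>0$, $\eta>0$) has kernel $\det\mathcal{B}^{(\alpha,\beta,\gamma,\eta)}$, where $\mathcal{B}^{(\alpha,\beta,\gamma,\eta)}(\boldsymbol z,\boldsymbol w)=[B_{(\alpha,\beta,\gamma)}(\boldsymbol z,\boldsymbol w)]^{\eta}\big(\frac{\partial^2}{\partial z_i\partial\overline{w}_j}\log B_{(\alpha,\beta,\gamma)}(\boldsymbol z,\boldsymbol w)\big)_{i,j=1}^2$; explicitly, $$\det\mathcal{B}^{(\alpha,\beta,\gamma,\eta)}(\boldsymbol z,\boldsymbol w)=(1-z_1\overline{w}_1)^{-2\alpha\eta}(1-z_2\overline{w}_2)^{-2\beta\eta}(1-z_1\overline{w}_2)^{2\gamma\eta}(1-z_2\overline{w}_1)^{2\gamma\eta}\left[\frac{\alpha\beta}{(1-z_1\overline{w}_1)^2(1-z_2\overline{w}_2)^2}-\frac{\gamma^2}{(1-z_1\overline{w}_2)^2(1-z_2\overline{w}_1)^2}\right].$$ $\mathbb{A}^{(\rho_1,\rho_2)}(\mathbb{D}^2)$ ($\rho_1,\rho_2>0$), the weighted Bergman module, has kernel $(1-z_1\bar w_1)^{-\rho_1}(1-z_2\bar w_2)^{-\rho_2}$. Each of these is an analytic Hilbert module: polynomials are contained and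 dense, and the operators $M_{z_1},M_{z_2}$ of multiplication by the coordinate functions are bounded. Each is Möb-homogeneous: the Taylor joint spectrum of $(M_{z_1},M_{z_2})$ lies in $\overline{\mathbb{D}}^2$ and $(\varphi(M_{z_1}),\varphi(M_{z_2}))$ is unitarily equivalent to $(M_{z_1},M_{z_2})$ for every biholomorphic automorphism $\varphi$ of $\mathbb{D}$. Two analytic Hilbert modules $\mathcal{H},\mathcal{H}'$ on $\mathbb{D}^2$ are unitarily equivalent if there is a unitary $U:\mathcal{H}\to\mathcal{H}'$ with $UM_{z_i}=M_{z_i}U$ for $i=1,2$. *)

(* Defs.v *)
From HB Require Import structures.
From mathcomp Require Import all_boot all_order all_algebra.
From mathcomp Require Import polyXY sesquilinear.
From mathcomp Require Import all_classical all_reals all_analysis.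
From mathcomp Require Import complex.

Set Implicit Arguments.
Unset Strict Implicit.
Unset Printing Implicit Defensive.

Import Order.TTheory GRing.Theory Num.Theory Num.Def.
Import numFieldNormedType.Exports.

Local Open Scope complex_scope.
Local Open Scope classical_set_scope.
Local Open Scope ring_scope.

Section PrincipalPowers.
Variable R : realType.
Implicit Types (z : R[i]) (s : R).

Definition modulus z : R := complex.Re `|z|.

(* Principal argument, with values in ]-pi, pi]. *)
Definition carg z : R :=
  let t := acos (complex.Re z / modulus z) in
  if 0 <= complex.Im z then t else - t.

Definition clog z : R[i] := ln (modulus z) +i* carg z.

Definition cexp z : R[i] :=
  (expR (complex.Re z))%:C * (cos (complex.Im z) +i* sin (complex.Im z)).

(* Principal branch of z ^ s; the value at z = 0 is irrelevant, since the
   kernels below only use bases 1 - z_i * conj w_j with z_i, w_j in the disc. *)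
Definition cpow z s : R[i] := cexp (s%:C * clog z).

End PrincipalPowers.

Definition bidisc (R : realType) : set (R[i]^o * R[i]^o) :=
  [set z | `|z.1| < 1 /\ `|z.2| < 1].
Arguments bidisc : clear implicits.

(* Hilbert spaces of holomorphic functions on the bidisc in which polynomials
   are contained and dense and multiplication by each coordinate function is
   bounded. An element f of the space is identified with the restriction to the
   bidisc of [ahm_fun f]: values outside the bidisc are never used.
   Differentiability is over the scalar field R[i], i.e. holomorphy. *)
Record analyticHilbertModule (R : realType) := AnalyticHilbertModule {
  ahm_space :> completeNormedModType R[i];
  ahm_dot : {dot ahm_space for (@conjC R[i])};
  ahm_dotE : forall f : ahm_space, ahm_dot f f = `|f| ^+ 2;
  ahm_fun : {linear ahm_space -> (R[i]^o * R[i]^o -> R[i]^o)};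
  ahm_fun_inj : forall f g : ahm_space,
    (forall z, bidisc R z -> ahm_fun f z = ahm_fun g z) -> f = g;
  ahm_fun_holomorphic : forall (f : ahm_space) z,
    bidisc R z -> differentiable (ahm_fun f) z;
  ahm_fun_bounded : forall z, bidisc R z ->
    exists c : R[i], forall f : ahm_space, `|ahm_fun f z| <= c * `|f|;
  ahm_poly : forall p : {poly {poly R[i]}}, exists f : ahm_space,
    forall z, bidisc R z -> ahm_fun f z = p.[z.1, z.2];
  ahm_poly_dense : dense [set f : ahm_space |
    exists p : {poly {poly R[i]}},
      forall z, bidisc R z -> ahm_fun f z = p.[z.1, z.2]];
  ahm_mul1 : {linear ahm_space -> ahm_space};
  ahm_mul1E : forall (f : ahm_space) z,
    bidisc R z -> ahm_fun (ahm_mul1 f) z = z.1 * ahm_fun f z;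
  ahm_mul1_bounded : exists c : R[i],
    forall f : ahm_space, `|ahm_mul1 f| <= c * `|f|;
  ahm_mul2 : {linear ahm_space -> ahm_space};
  ahm_mul2E : forall (f : ahm_space) z,
    bidisc R z -> ahm_fun (ahm_mul2 f) z = z.2 * ahm_fun f z;
  ahm_mul2_bounded : exists c : R[i],
    forall f : ahm_space, `|ahm_mul2 f| <= c * `|f|
}.

Definition unitarily_equivalent (R : realType)
    (H H' : analyticHilbertModule R) : Prop :=
  exists U : {linear H -> H'},
    [/\ bijective U,
        forall f g : H, ahm_dot H' (U f) (U g) = ahm_dot H f g,
        forall f : H, U (ahm_mul1 H f) = ahm_mul1 H' (U f)
      & forall f : H, U (ahm_mul2 H f) = ahm_mul2 H' (U f)].

Definition reproducing_kernel (R : realType) (H : analyticHilbertModule R)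
    (K : R[i]^o * R[i]^o -> R[i]^o * R[i]^o -> R[i]) : Prop :=
  forall w, bidisc R w -> exists Kw : H,
    (forall z, bidisc R z -> ahm_fun H Kw z = K z w) /\
    (forall f : H, ahm_fun H f w = ahm_dot H f Kw).

Section Kernels.
Variable R : realType.
Implicit Types (z w : R[i]^o * R[i]^o).

Definition kernel_A (la mu nu : R) z w : R[i] :=
  (4 * cpow (1 - z.1 * conjC w.1) (mu + la)
     * cpow (1 - z.2 * conjC w.2) (nu + la))^-1 *
  (1 / (cpow (1 - z.1 * conjC w.1) (2 * la) *
        cpow (1 - z.2 * conjC w.2) (2 * la)) +
   3 / (cpow (1 - z.1 * conjC w.2) (2 * la) *
        cpow (1 - z.2 * conjC w.1) (2 * la))).

Definition kernel_B (al be ga : R) z w : R[i] :=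
  cpow (1 - z.1 * conjC w.1) (- al) * cpow (1 - z.2 * conjC w.2) (- be) *
  cpow (1 - z.1 * conjC w.2) ga * cpow (1 - z.2 * conjC w.1) ga.

(* Closed form of the determinant of
   B ^ eta * (d^2 log B / dz_i d(conj w_j))_(i,j) with B := kernel_B al be ga. *)
Definition kernel_detB (al be ga eta : R) z w : R[i] :=
  cpow (1 - z.1 * conjC w.1) (- (2 * al * eta)) *
  cpow (1 - z.2 * conjC w.2) (- (2 * be * eta)) *
  cpow (1 - z.1 * conjC w.2) (2 * ga * eta) *
  cpow (1 - z.2 * conjC w.1) (2 * ga * eta) *
  ((al * be)%:C /
     ((1 - z.1 * conjC w.1) ^+ 2 * (1 - z.2 * conjC w.2) ^+ 2) -
   (ga ^+ 2)%:C /
     ((1 - z.1 * conjC w.2) ^+ 2 * (1 - z.2 * conjC w.1) ^+ 2)).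

Definition kernel_bergman (r1 r2 : R) z w : R[i] :=
  cpow (1 - z.1 * conjC w.1) (- r1) * cpow (1 - z.2 * conjC w.2) (- r2).

End Kernels.

Section Families.
Variable R : realType.
Implicit Types (H : analyticHilbertModule R).

Definition family_A H : Prop := exists la mu nu : R,
  [/\ 0 < la, 0 < mu, 0 < nu & reproducing_kernel H (kernel_A la mu nu)].

Definition family_H H : Prop := exists al be ga : R,
  [/\ ga < al, ga < be, 0 < ga & reproducing_kernel H (kernel_B al be ga)].

Definition family_detH H : Prop := exists al be ga eta : R,
  [/\ ga < al, ga < be, 0 < ga, 0 < eta
    & reproducing_kernel H (kernel_detB al be ga eta)].

Definition weighted_bergman H : Prop := exists r1 r2 : R,
  [/\ 0 < r1, 0 < r2 & reproducing_kernel H (kernel_bergman r1 r2)].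

Definition never_equivalent (F G : analyticHilbertModule R -> Prop) : Prop :=
  forall H H', F H -> G H' -> ~ unitarily_equivalent H H'.

End Families.

(* Main.v *)
(** A unitary intertwiner [U : H -> H'] is multiplication by [phi = U 1], since
    it is so on the dense set of polynomials; hence
    [K'(z, w) = phi(z) conj(phi(w)) K(z, w)]. All the kernels at hand are
    constant in [z] when [w = 0], which forces [phi] to be constant, so the
    kernels normalised at the origin coincide. At [z = (x, 0)], [w = (0, x)],
    with [c = 1 - x ^ 2] in [(0, 1)], the normalised kernels are
    [(1 + 3 c ^ (- 2 la)) / 4 > 1] for [A], [c ^ ga] in [(0, 1)] for [H], [1]
    for the Bergman module, while that of [det B], proportional to
    [c ^ (2 ga eta) (al be - ga ^ 2 / c ^ 2)], is negative for small [c]. *)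
Require Import Defs.
From mathcomp Require Import all_boot all_order all_algebra.
From mathcomp Require Import polyXY sesquilinear.
From mathcomp Require Import all_classical all_reals all_analysis.
From mathcomp Require Import complex ring lra.

Set Implicit Arguments.
Unset Strict Implicit.
Unset Printing Implicit Defensive.

Import Order.TTheory GRing.Theory Num.Theory Num.Def.
Import numFieldNormedType.Exports.

Local Open Scope complex_scope.
Local Open Scope classical_set_scope.
Local Open Scope ring_scope.

(** * Intertwiners as multiplication operators, and their effect on reproducing kernels *)

Section UnitaryEquivalence.
Variable R : realType.
Implicit Types H : analyticHilbertModule R.

(** If [h] were nonzero, density would give a polynomial [f] at distance less than [|h|] from [h],
    whereas orthogonality and Pythagoras give [|h - f| ^+ 2 =]|h| ^+ 2 + [|f| ^+ 2]. *)
Lemma ahm_poly_dense_orthogonal H (h : H) :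
  (forall (p : {poly {poly R[i]}}) (f : H),
     (forall z, bidisc R z -> ahm_fun H f z = p.[z.1, z.2]) ->
     ahm_dot H f h = 0) -> h = 0.
Proof.
move=> hp; apply/eqP; apply: contraT => h0.
have nh : 0 < `|h| by rewrite normr_gt0.
have [|f [hf [p fp]]] :=
  @ahm_poly_dense R H (ball h `|h|) _ (ball_open h `|h|).
  by exists h; exact: ballxx.
have fh := hp p f fp.
have hf0 : ahm_dot H h f = 0 by rewrite hermC (_ : _ f h = 0) ?fh // rmorph0 mulr0.
have : `|h - f| ^+ 2 = `|h| ^+ 2 + `|f| ^+ 2.
  by rewrite -!ahm_dotE linearBl !linearBr /= fh hf0 subr0 sub0r opprK.
move: hf; rewrite -ball_normE /= => hf E.
have : `|h - f| ^+ 2 < `|h| ^+ 2 by rewrite ltr_pXn2r ?nnegrE.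
by rewrite E gtrDl le_gtF ?exprn_ge0 ?normr_ge0.
Qed.

(** An element is determined by its values on the bidisc, so it suffices to build one representative
    of [p] from [e] by Horner's scheme, since [U] respects sums, scalars and both
    multiplications. *)
Lemma intertwiner_mul_poly H H' (U : {linear H -> H'}) (e : H) :
  (forall z, bidisc R z -> ahm_fun H e z = 1) ->
  (forall f : H, U (ahm_mul1 H f) = ahm_mul1 H' (U f)) ->
  (forall f : H, U (ahm_mul2 H f) = ahm_mul2 H' (U f)) ->
  forall (p : {poly {poly R[i]}}) (f : H),
    (forall z, bidisc R z -> ahm_fun H f z = p.[z.1, z.2]) ->
  forall z, bidisc R z ->
    ahm_fun H' (U f) z = p.[z.1, z.2] * ahm_fun H' (U e) z.
Proof.
move=> He U1 U2 p f fp.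
suff [g gp Ugp] : exists2 g : H,
    forall z, bidisc R z -> ahm_fun H g z = p.[z.1, z.2] &
    forall z, bidisc R z ->
      ahm_fun H' (U g) z = p.[z.1, z.2] * ahm_fun H' (U e) z.
  suff -> : f = g by [].
  by apply: ahm_fun_inj => z zD; rewrite fp ?gp.
(* The outer induction is in the variable [z.1]; the coefficient [c] is itself a polynomial in [z.2]
   and gets its own representative by an inner induction. *)
elim/poly_ind: p {f fp} => [|p c [f fp Ufp]].
  exists 0 => z zD; rewrite !linear0 !horner0 ?mul0r //.
have [g gc Ugc] : exists2 g : H,
    forall z, bidisc R z -> ahm_fun H g z = c.[z.2] &
    forall z, bidisc R z ->
      ahm_fun H' (U g) z = c.[z.2] * ahm_fun H' (U e) z.
  elim/poly_ind: c => [|c a [g gc Ugc]].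
    by exists 0 => z zD; rewrite !linear0 horner0 ?mul0r.
  exists (ahm_mul2 H g + a *: e) => z zD.
    by rewrite linearD linearZ /= !fctE ahm_mul2E // gc // He // !hornerE mulrC
      /GRing.scale /= mulr1.
  rewrite !linearD !linearZ /= !fctE U2 ahm_mul2E // Ugc // !hornerE.
  by rewrite /GRing.scale /=; ring.
exists (ahm_mul1 H f + g) => z zD.
  by rewrite linearD /= !fctE ahm_mul1E // fp // gc // !hornerE mulrC.
rewrite !linearD /= !fctE U1 ahm_mul1E // Ufp // Ugc // !hornerE /=; ring.
Qed.

(** The factor [phi] is [U e] with [e] the constant function 1. The kernel [K' z w] is the inner
    product of the kernel vectors at [w] and [z], and the isometry lets it be computed in [H] after
    applying [V]. *)
Lemma unitarily_equivalent_kernels H H' K K' :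
  unitarily_equivalent H H' ->
  reproducing_kernel H K -> reproducing_kernel H' K' ->
  exists phi : R[i]^o * R[i]^o -> R[i], forall z w,
    bidisc R z -> bidisc R w -> K' z w = phi z * conjC (phi w) * K z w.
Proof.
move=> [U [[V UV VU] Uiso U1 U2]] HK HK'.
have [e He] := ahm_poly H 1.
have e1 z : bidisc R z -> ahm_fun H e z = 1 by move=> zD; rewrite He // !hornerE.
have Upoly := intertwiner_mul_poly e1 U1 U2.
exists (ahm_fun H' (U e)) => z w zD wD.
(* [V] is the adjoint of [U], and the adjoint of multiplication by [phi] scales the kernel vector at
   [v] by the conjugate of [phi v]. Testing against polynomials suffices. *)
have kernelE v Kv Kv' : bidisc R v ->
    (forall f : H, ahm_fun H f v = ahm_dot H f Kv) ->
    (forall f : H', ahm_fun H' f v = ahm_dot H' f Kv') ->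
    V Kv' = conjC (ahm_fun H' (U e) v) *: Kv.
  move=> vD KvE KvE'; apply/eqP; rewrite -subr_eq0; apply/eqP.
  apply: ahm_poly_dense_orthogonal => p f fp.
  rewrite linearBr /= linearZr_LR /= -Uiso VU -KvE' -KvE fp // (Upoly p) //.
  by rewrite conjCK mulrC subrr.
have [Kw [KwE Kwrep]] := HK _ wD; have [Kw' [KwE' Kwrep']] := HK' _ wD.
have [Kz [KzE Kzrep]] := HK _ zD; have [Kz' [KzE' Kzrep']] := HK' _ zD.
rewrite -KwE' // Kzrep' -(VU Kw') -(VU Kz') Uiso.
rewrite (kernelE w Kw) // (kernelE z Kz) //.
by rewrite linearZl_LR linearZr_LR /= -Kzrep KwE // conjCK; ring.
Qed.

(** At [w = 0] the transformation rule makes [phi z * conjC (phi (0, 0)) * K (0, 0) (0, 0)]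
    independent of [z], so [phi] is constant on the bidisc. The cross-multiplied form avoids
    division by the values at the origin. *)
Lemma unitarily_equivalent_normalized_kernels H H' K K' :
  unitarily_equivalent H H' ->
  reproducing_kernel H K -> reproducing_kernel H' K' ->
  (forall z, K z (0, 0) = K (0, 0) (0, 0)) ->
  (forall z, K' z (0, 0) = K' (0, 0) (0, 0)) ->
  K' (0, 0) (0, 0) != 0 ->
  forall z w, bidisc R z -> bidisc R w ->
    K' z w * K (0, 0) (0, 0) = K' (0, 0) (0, 0) * K z w.
Proof.
move=> HH' HK HK' K0 K'0 K'00 z w zD wD.
have [phi phiE] := unitarily_equivalent_kernels HH' HK HK'.
have oD : bidisc R (0, 0) by split; rewrite normr0.
have E0 := phiE _ _ oD oD.
have [p0 k0] : conjC (phi (0, 0)) != 0 /\ K (0, 0) (0, 0) != 0.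
  by move: K'00; rewrite E0 !mulf_eq0 !negb_or => /andP[/andP[_ ->] ->].
have phi0 v : bidisc R v -> phi v = phi (0, 0).
  move=> vD; apply: (mulIf p0); apply: (mulIf k0).
  by rewrite -E0 -(K0 v) -phiE // K'0.
rewrite (phiE z w) // E0 (phi0 z) // (phi0 w) //; ring.
Qed.

End UnitaryEquivalence.

(** * Normalised kernel values at the pairs [(x, 0)], [(0, x)] *)

Section SkewKernel.
Variable R : realType.
Implicit Types (H : analyticHilbertModule R) (c s : R).

(** The principal argument of a positive real is [acos 1 = 0], so [clog] reduces to the real
    logarithm. *)
Lemma cpow_real c s : 0 < c -> cpow c%:C s = (c `^ s)%:C.
Proof.
move=> c0; have mc : modulus c%:C = c.
  by rewrite /modulus normc_def /= expr0n addr0 sqrtr_sqr gtr0_norm.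
rewrite /cpow /clog /carg mc /= lexx divff ?gt_eqF // acos1 /cexp /=.
by rewrite /powR gt_eqF //; simpc; rewrite cos0 sin0; simpc.
Qed.

Lemma cpow1 s : cpow (1 : R[i]) s = 1.
Proof. by rewrite (cpow_real s ltr01) powR1. Qed.

(* Here [1 - z.1 * conj w.2 = c] and the other three bases are [1]. *)
Definition skew_value (K : R[i]^o * R[i]^o -> R[i]^o * R[i]^o -> R[i]) c :=
  K ((sqrtr (1 - c))%:C, 0) (0, (sqrtr (1 - c))%:C).

Lemma skew_base c : c < 1 ->
  1 - (sqrtr (1 - c))%:C * conjC (sqrtr (1 - c))%:C = c%:C.
Proof.
move=> c1; rewrite -sqr_normc normc_def /= expr0n addr0 -rmorphXn /=.
rewrite sqr_sqrtr ?sqr_ge0 // sqr_sqrtr ?subr_ge0 ?ltW //.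
by rewrite rmorphB rmorph1 subKr.
Qed.

Lemma skew_points_bidisc c : 0 < c ->
  bidisc R ((sqrtr (1 - c))%:C, 0) /\ bidisc R (0, (sqrtr (1 - c))%:C).
Proof.
move=> c0; have lt1 : `|(sqrtr (1 - c))%:C : R[i]| < 1.
  rewrite normc_def /= expr0n addr0 sqrtr_sqr ger0_norm ?sqrtr_ge0 //.
  by rewrite -[ltRHS]/(1%:C) ltcR -[ltRHS]sqrtr1 ltr_sqrt // gtrDl oppr_lt0.
by do !split => //=; rewrite normr0.
Qed.


Lemma powR_lt1 c s : 0 < c < 1 -> 0 < s -> c `^ s < 1.
Proof.
move=> c01 s0; have /andP[c0 _] := c01.
by rewrite /powR gt_eqF // -expR0 ltr_expR pmulr_rlt0 // ln_lt0.
Qed.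

(** Hiding [K] and [k] leaves only [f], the normalised kernel as a function of [c]; by the next
    lemma it is a unitary invariant on [0 < c < 1]. *)
Definition normalized_skew_kernel H (f : R -> R) :=
  exists K (k : R), [/\ 0 < k, reproducing_kernel H K,
    forall z, K z (0, 0) = k%:C &
    forall c, 0 < c < 1 -> skew_value K c = (k * f c)%:C].

Lemma unitarily_equivalent_skew_kernel H H' f g :
  unitarily_equivalent H H' ->
  normalized_skew_kernel H f -> normalized_skew_kernel H' g ->
  forall c, 0 < c < 1 -> f c = g c.
Proof.
move=> HH' [K [k [k0 HK K0 Kf]]] [K' [k' [k'0 HK' K'0 K'g]]] c c01.
have [c0 c1] := andP c01; have [zD wD] := skew_points_bidisc c0.
have k'C : (k'%:C : R[i]) != 0 by rewrite eq_complex /= gt_eqF.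
have := unitarily_equivalent_normalized_kernels HH' HK HK' _ _ _ zD wD.
rewrite -/(skew_value K c) -/(skew_value K' c) Kf // K'g // K0 K'0.
move=> /(_ K0 K'0 k'C); rewrite -!rmorphM /= => /complexI.
rewrite mulrAC [RHS]mulrA => /(mulfI _) E; apply/esym/E.
by rewrite mulf_neq0 ?gt_eqF.
Qed.

Lemma family_A_skew_kernel H : family_A H ->
  exists2 f, normalized_skew_kernel H f & forall c, 0 < c < 1 -> 1 < f c.
Proof.
move=> [la [mu [nu [la0 mu0 nu0 HK]]]].
exists (fun c => (1 + 3 / c `^ (2 * la)) / 4) => [|c /andP[c0 c1]]; last first.
  have p0 := powR_gt0 (2 * la) c0.
  have p1 : c `^ (2 * la) < 1.
    by rewrite powR_lt1 ?c0 // mulr_gt0.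
  have : 1 < (c `^ (2 * la))^-1 by rewrite invf_gt1.
  lra.
exists (kernel_A la mu nu), 1; split => // [z|c /andP[c0 c1]].
  rewrite /kernel_A /= conjC0 !mulr0 subr0 !cpow1 !mulr1 divr1.
  by field.
rewrite /skew_value /kernel_A /= conjC0 !mulr0 !mul0r !subr0 !cpow1 skew_base //.
rewrite cpow_real // !mulr1 !mul1r invr1.
by rewrite [RHS]rmorphM /= rmorphD rmorphM /= !fmorphV !rmorph_nat mulrC.
Qed.

Lemma family_H_skew_kernel H : family_H H ->
  exists2 f, normalized_skew_kernel H f & forall c, 0 < c < 1 -> 0 < f c < 1.
Proof.
move=> [al [be [ga [gaal gabe ga0 HK]]]].
exists (fun c => c `^ ga) => [|c /andP[c0 c1]]; last first.
  by rewrite powR_gt0 // powR_lt1 ?c0.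
exists (kernel_B al be ga), 1; split => // [z|c /andP[c0 c1]].
  by rewrite /kernel_B /= conjC0 !mulr0 subr0 !cpow1 !mulr1.
rewrite /skew_value /kernel_B /= conjC0 !mulr0 !mul0r !subr0 !cpow1 skew_base //.
by rewrite cpow_real // !mulr1 !mul1r.
Qed.

Lemma family_detH_skew_kernel H : family_detH H ->
  exists2 f, normalized_skew_kernel H f & exists2 c, 0 < c < 1 & f c < 0.
Proof.
move=> [al [be [ga [eta [gaal gabe ga0 eta0 HK]]]]].
have al0 := lt_trans ga0 gaal; have be0 := lt_trans ga0 gabe.
have ab0 : 0 < al * be by rewrite mulr_gt0.
have ga2 : 0 < ga ^+ 2 by rewrite exprn_gt0.
have gaab : ga ^+ 2 < al * be by rewrite expr2 ltr_pM // ltW.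
pose k := al * be - ga ^+ 2; have k0 : 0 < k by rewrite subr_gt0.
exists (fun c => c `^ (2 * ga * eta) * (al * be - ga ^+ 2 / c ^+ 2) / k); last first.
  (* For this [c < 1] the bracket equals [al * be * (1 - al * be / ga ^+ 2)], which is negative
     because [ga ^+ 2 < al * be]. *)
  exists (ga ^+ 2 / (al * be)).
    by rewrite divr_gt0 // ltr_pdivrMr // mul1r.
  rewrite pmulr_llt0 ?invr_gt0 // pmulr_rlt0 ?powR_gt0 ?divr_gt0 //.
  have -> : ga ^+ 2 / (ga ^+ 2 / (al * be)) ^+ 2 =
      (al * be) * ((al * be) / ga ^+ 2).
    by field; rewrite !gt_eqF.
  by rewrite subr_lt0 ltr_pMr // ltr_pdivlMr // mul1r.
exists (kernel_detB al be ga eta), k; split => // [z|c /andP[c0 c1]].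
  rewrite /kernel_detB /= conjC0 !mulr0 subr0 !cpow1 !expr1n !mulr1 !divr1 mul1r.
  by rewrite rmorphB.
rewrite /skew_value /kernel_detB /= conjC0 !mulr0 !mul0r !subr0 !cpow1 skew_base //.
rewrite cpow_real // !expr1n !mulr1 !mul1r divr1.
rewrite mulrCA divff ?gt_eqF // mulr1.
by rewrite -rmorphXn -fmorphV -rmorphM -rmorphB -rmorphM.
Qed.

(** The kernel pairs [z.1] only with [w.1] and [z.2] only with [w.2], and each of these products
    vanishes at the skew points. *)
Lemma weighted_bergman_skew_kernel H : weighted_bergman H ->
  normalized_skew_kernel H (fun=> 1).
Proof.
move=> [r1 [r2 [r10 r20 HK]]].
exists (kernel_bergman r1 r2), 1; split => // [z|c /andP[c0 c1]].
  by rewrite /kernel_bergman /= conjC0 !mulr0 subr0 !cpow1 mulr1.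
by rewrite /skew_value /kernel_bergman /= conjC0 mulr0 mul0r subr0 !cpow1 !mulr1.
Qed.

End SkewKernel.

Theorem theorem4p6 (R : realType) :
  (never_equivalent (@family_A R) (@family_H R) /\
   never_equivalent (@family_A R) (@family_detH R) /\
   never_equivalent (@family_H R) (@family_detH R)) /\
  (never_equivalent (@family_A R) (@weighted_bergman R) /\
   never_equivalent (@family_H R) (@weighted_bergman R) /\
   never_equivalent (@family_detH R) (@weighted_bergman R)).
Proof.
(* An arbitrary sample point for the pairs without [family_detH], whose bounds hold on all of
   [0 < c < 1]; the other pairs are compared at the point where the determinant kernel is
   negative. *)
have half01 : 0 < (2^-1 : R) < 1 by rewrite invr_gt0 invf_lt1 ?ltr0n ?ltr1n.
split; split; [|split| |split] => H H'.
- move=> /family_A_skew_kernel[f Hf f1] /family_H_skew_kernel[g Hg g1] HH'.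
  have := f1 _ half01; rewrite (unitarily_equivalent_skew_kernel HH' Hf Hg) //.
  by have /andP[_ /ltW] := g1 _ half01; rewrite leNgt => /negbTE ->.
- move=> /family_A_skew_kernel[f Hf f1] /family_detH_skew_kernel[g Hg] [c c01 g0] HH'.
  have := f1 _ c01; rewrite (unitarily_equivalent_skew_kernel HH' Hf Hg) //.
  by move=> /(lt_trans ltr01); rewrite ltNge (ltW g0).
- move=> /family_H_skew_kernel[f Hf f0] /family_detH_skew_kernel[g Hg] [c c01 g0] HH'.
  have /andP[+ _] := f0 _ c01.
  by rewrite (unitarily_equivalent_skew_kernel HH' Hf Hg) // ltNge (ltW g0).
- move=> /family_A_skew_kernel[f Hf f1] /weighted_bergman_skew_kernel Hg HH'.
  have := f1 _ half01.
  by rewrite (unitarily_equivalent_skew_kernel HH' Hf Hg) // ltxx.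
- move=> /family_H_skew_kernel[f Hf f1] /weighted_bergman_skew_kernel Hg HH'.
  have /andP[_] := f1 _ half01.
  by rewrite (unitarily_equivalent_skew_kernel HH' Hf Hg) // ltxx.
- move=> /family_detH_skew_kernel[f Hf] [c c01 f0] /weighted_bergman_skew_kernel Hg HH'.
  by move: f0; rewrite (unitarily_equivalent_skew_kernel HH' Hf Hg) // ltNge ler01.
Qed.
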